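(* For every $n\in\mathbb{N}$, the expectation of the random variable $P_n^{\text{park}}=P_n^{\text{park}}(\sigma)$ on $(S_n,P_n)$ is $$E_nP_n^{\text{park}}=\frac1{n!},$$ and $$E_nP_n^{\text{park}}\sim\frac{e^n}{\sqrt{2\pi}\,n^{n+\frac12}}\quad\text{as }n\to\infty.$$
   Context: $[n]=\{1,\dots,n\}$; $S_n$ is the set of permutations $\sigma=\sigma_1\cdots\sigma_n$ of $[n]$; $P_n$ is the uniform probability measure on $S_n$ and $E_n$ the corresponding expectation. Parking: cars $1,\dots,n$ arrive in this order on a one-way street with spaces $1,\dots,n$; given a sequence $\pi=(\pi_1,\dots,\pi_n)\in[n]^n$ of preferred spaces, car $i$ parks in space $\pi_i$ if it is free, and otherwise in the first free space with number greater than $\pi_i$, if one exists (if none exists the car exits the street). $\pi$ is a parking function on $[n]$ if all $n$ cars are able to park; $\mathcal{P}_n$ is the set of parking functions on $[n]$. The map $T_n:\mathcal{P}_n\to S_n$ is $T_n(\pi)=\sigma$, where $\sigma_j$ is the number of the car that parked in space $j$, $j\in[n]$. The probability measure $P_n^{\text{park}}$ on $S_n$ is $P_n^{\text{park}}(\sigma)=|T_n^{-1}(\{\sigma\})|/|\mathcal{P}_n|$. $a_n\sim b_n$ means $a_n/b_n\to1$. *)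

(* Defs.v *)
From HB Require Import structures.
From mathcomp Require Import all_boot all_order all_algebra all_fingroup.
From mathcomp Require Import all_classical all_reals all_analysis.

Set Implicit Arguments.
Unset Strict Implicit.
Unset Printing Implicit Defensive.

Import Order.TTheory GRing.Theory Num.Theory.
Import numFieldNormedType.Exports.

Local Open Scope ring_scope.

(* The cars 1, ..., n and the spaces 1, ..., n are both represented by 'I_n,
   i.e. renumbered from 0. *)

(* [st j] is the car standing in space [j], or [None] if [j] is free. *)
Definition street (n : nat) := {ffun 'I_n -> option 'I_n}.

(* [enum 'I_n] is increasing, so this is the free space of smallest number
   among those with number at least [p]; it is [p] itself when [p] is free. *)
Definition first_free (n : nat) (st : street n) (p : 'I_n) : option 'I_n :=
  ohead [seq j : 'I_n <- enum 'I_n | (p <= j)%N && (st j == None)].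

Definition park_car (n : nat) (pref : {ffun 'I_n -> 'I_n}) (st : street n)
    (i : 'I_n) : street n :=
  if first_free st (pref i) is Some j
  then [ffun k => if k == j then Some i else st k]
  else st.

Definition park_all (n : nat) (pref : {ffun 'I_n -> 'I_n}) : street n :=
  foldl (park_car pref) [ffun=> None] (enum 'I_n).

(* A car that finds no free space leaves [st] unchanged, so it is parked
   nowhere at the end. *)
Definition parking_functions (n : nat) : {set {ffun 'I_n -> 'I_n}} :=
  [set pref | [forall i : 'I_n, exists j : 'I_n, park_all pref j == Some i]].

Definition parking_function (n : nat) :=
  {pref : {ffun 'I_n -> 'I_n} | pref \in parking_functions n}.

(* The default value [j] is never used: see [park_all_occupant]. *)
Definition occupant (n : nat) (pf : parking_function n) (j : 'I_n) : 'I_n :=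
  odflt j (park_all (val pf) j).

Lemma park_all_occupant (n : nat) (pf : parking_function n) (j : 'I_n) :
  park_all (val pf) j = Some (occupant pf j).
Proof.
case: pf => pref prefP; rewrite /occupant /=.
move: (prefP); rewrite inE => /forallP parked.
pose space i := xchoose (existsP (parked i)).
have spaceP i : park_all pref (space i) = Some i.
  exact/eqP/(xchooseP (existsP (parked i))).
have space_inj : injective space.
  by move=> i i' ee; have := spaceP i; rewrite ee spaceP => -[].
have [car _ carK] := injF_bij space_inj.
by rewrite -(carK j) spaceP.
Qed.

Lemma occupant_inj (n : nat) (pf : parking_function n) :
  injective (occupant pf).
Proof.
move: (valP pf); rewrite inE => /forallP parked.
have surj i : exists j, occupant pf j == i.
  have /existsP[j] := parked i.
  by rewrite park_all_occupant => /eqP[<-]; exists j.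
pose space i := xchoose (surj i).
have spaceK : cancel space (occupant pf).
  by move=> i; exact/eqP/(xchooseP (surj i)).
exact: bij_inj (bij_can_bij (injF_bij (can_inj spaceK)) spaceK).
Qed.

Definition parking_perm (n : nat) (pf : parking_function n) : 'S_n :=
  perm (@occupant_inj n pf).

Definition park_prob (R : realType) (n : nat) (s : 'S_n) : R :=
  #|[set pf : parking_function n | parking_perm pf == s]|%:R
    / #|parking_functions n|%:R.

Definition unif_prob (R : realType) (n : nat) (A : {set 'S_n}) : R :=
  #|A|%:R / #|[set: 'S_n]|%:R.

Definition unif_expectation (R : realType) (n : nat) (X : 'S_n -> R) : R :=
  \sum_(s : 'S_n) X s * unif_prob R [set s].

Definition asymp_equiv (R : realType) (a b : nat -> R) : Prop :=
  ((fun n => a n / b n) @ \oo --> (1 : R))%classic.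

(* Main.v *)
Require Import Defs.
From mathcomp Require Import all_boot all_order all_algebra all_fingroup.
From mathcomp Require Import all_classical all_reals all_analysis.
From mathcomp Require Import ring lra.

Set Implicit Arguments.
Unset Strict Implicit.
Unset Printing Implicit Defensive.

Import Order.TTheory GRing.Theory Num.Theory.
Import numFieldNormedType.Exports.

Local Open Scope ring_scope.

(** The parking probability is a probability measure on the permutations, so
its average over all [n!] of them is [1 / n!].  Its total mass is 1 because the
fibres of [parking_perm] partition the parking functions; the quotient makes
sense because there is at least one parking function, the identity
([id_parking_function]).

The asymptotic statement is then Stirling's formula ([stirling]): the ratio
[A n = n! e^n / (n^n sqrt n)] tends to [sqrt (2 pi)].

- Convergence to some [c > 0] ([cvg_stirling_ratio_gt0]).  The decrement
  [ln A(n) - ln A(n+1)] is [(n + 1/2) ln (1 + 1/n) - 1].  The lower bound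
  [2x/(2+x)] of [ln (1+x)] makes it nonnegative, and the upper bound
  [x(2+x)/(2(1+x))] makes it at most [1/(4n) - 1/(4(n+1))], which telescopes.
  So [ln A] is nonincreasing and bounded below.

- Value of [c].  Let [J n] be the integral of [sin^n] over [[0, pi/2]].  From
  [J (n+2) = (n+1)/(n+2) J n] follow the invariant [(n+1) J(n) J(n+1) = pi/2]
  and a closed form of [J (2n)] in terms of factorials.  Since [J] is
  nonincreasing, the invariant squeezes [n J(n)^2] to [pi/2]
  ([cvg_sin_int], a form of Wallis' product).  The closed form also gives
  [A(n)^4 (2n J(2n)^2) = pi^2 A(2n)^2] ([stirling_ratio_double]), and in the
  limit [c^4 pi/2 = pi^2 c^2], that is [c^2 = 2 pi]. *)

(** * The mean of the parking probability *)

(** The enumeration is increasing, so every space listed before [p] is discarded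
by the condition [p <= j], and [p] is the first one kept. *)
Lemma first_free_pref (n : nat) (st : street n) (p : 'I_n) :
  st p = None -> first_free st p = Some p.
Proof.
move=> stp; rewrite /first_free.
have : sorted ltn (map val (enum 'I_n)) by rewrite val_enum_ord iota_ltn_sorted.
have : p \in enum 'I_n by rewrite mem_enum.
case/splitPr => s1 s2; rewrite map_cat sorted_pairwise; last exact: ltn_trans.
rewrite pairwise_cat allrel_consr => /andP[/andP[/allP s1p _] _].
rewrite filter_cat /= leqnn stp eqxx /=.
have -> : [seq j : 'I_n <- s1 | (p <= j)%N && (st j == None)] = [::] => //.
apply/eqP; rewrite -[_ == _]negbK -has_filter; apply/hasPn => j js.
have /= jp := s1p _ (map_f val js).
by rewrite negb_and -ltnNge jp.
Qed.

(** Every car finds its preferred space free, so parking the cars of a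
duplicate-free list on a street whose spaces of these numbers are free puts
each of them in its own space; the induction is over that list. *)
Lemma id_parking_function (n : nat) :
  [ffun i : 'I_n => i] \in parking_functions n.
Proof.
rewrite inE; apply/forallP => i; apply/existsP; exists i; apply/eqP.
set pref := [ffun _ => _].
suff parkE (s : seq 'I_n) (st : street n) : uniq s ->
    {in s, forall i, st i = None} ->
    foldl (park_car pref) st s = [ffun j => if j \in s then Some j else st j].
  by rewrite /park_all parkE ?enum_uniq// => [|j _]; rewrite ffunE// mem_enum.
elim: s st => [|j s IH] st /=.
  by move=> _ _; apply/ffunP => k; rewrite ffunE.
move=> /andP[js us] st0.
have parkj : park_car pref st j = [ffun k => if k == j then Some j else st k].
  by rewrite /park_car ffunE first_free_pref// st0// mem_head.
rewrite parkj IH//.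
  apply/ffunP => k; rewrite !ffunE in_cons.
  by case: (eqVneq k j) => [->|//]; rewrite (negPf js).
move=> k ks; rewrite ffunE; case: eqP => [kj|_]; first by rewrite -kj ks in js.
by apply: st0; rewrite in_cons ks orbT.
Qed.

Lemma sum_park_prob (R : realType) (n : nat) :
  \sum_(s : 'S_n) park_prob R s = 1.
Proof.
rewrite -big_distrl /= -natr_sum.
have -> : (\sum_(s : 'S_n)
      #|[set pf : parking_function n | parking_perm pf == s]|
    = #|parking_functions n|)%N.
  rewrite -[RHS]card_sig -sum1_card.
  rewrite (partition_big (@parking_perm n) xpredT)//=.
  by apply: eq_bigr => s _; rewrite sum1dep_card.
rewrite divff// pnatr_eq0 -lt0n; apply/card_gt0P.
by exists [ffun i => i]; exact: id_parking_function.
Qed.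

Lemma unif_expectation_park_prob (R : realType) (n : nat) :
  unif_expectation (@park_prob R n) = 1 / n`!%:R.
Proof.
rewrite -[X in X / _](sum_park_prob R n) mulr_suml.
by apply: eq_bigr => s _; rewrite /unif_prob cards1 cardsT card_Sn div1r.
Qed.

(** * Bounds on the logarithm *)

Lemma is_derive_ge0_le (R : realType) (f f' : R -> R) (a b : R) :
  a <= b -> (forall x : R, is_derive x 1 f (f' x)) ->
  (forall x, x \in `[a, b] -> 0 <= f' x) -> f a <= f b.
Proof.
move=> ab df f'0.
have [|c cab dE] := @MVT_segment R f f' a b ab (fun x _ => df x).
  by apply: derivable_within_continuous => x _; have [] := df x.
by rewrite -subr_ge0 dE mulr_ge0 ?f'0// subr_ge0.
Qed.

(** With [t = ln (1+x)] the claim reads [2 (e^t - 1) <= t (e^t + 1)].  The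
difference vanishes at 0 and has derivative [t e^t - e^t + 1], which is
nonnegative because [1 - t <= e^(-t)]. *)
Lemma ln1p_ge (R : realType) (x : R) : 0 <= x -> 2 * x / (2 + x) <= ln (1 + x).
Proof.
move=> x0; set t := ln (1 + x).
have t0 : 0 <= t by rewrite ln_ge0// lerDl.
have et : expR t = 1 + x by rewrite lnK// posrE ltr_pwDl.
pose f : R -> R := id * (expR + cst 1) - 2 *: (expR - cst 1).
have df (s : R) : is_derive s 1 f (s * expR s - expR s + 1).
  rewrite /f; apply: is_derive_eq; rewrite /= !fctE /GRing.scale/=; ring.
have := is_derive_ge0_le t0 df; rewrite /f /= !fctE /GRing.scale/= expR0 et.
move=> H; rewrite ler_pdivrMr ?ltr_wpDr//.
suff : 0 <= t * (1 + x + 1) - 2 * (1 + x - 1) by lra.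
apply: le_trans (H _); first by lra.
move=> s _; have := expR_ge1Dx (- s); rewrite expRN => es.
have e0 := expR_gt0 s.
have : (1 - s) * expR s <= 1 by rewrite -ler_pdivlMr// div1r.
by lra.
Qed.

(** With [t = ln (1+x)] the right-hand side is [sinh t], and [t <= sinh t]
because the derivative of [sinh] is at least 1. *)
Lemma ln1p_le (R : realType) (x : R) :
  0 <= x -> ln (1 + x) <= x * (2 + x) / (2 * (1 + x)).
Proof.
move=> x0; set t := ln (1 + x).
have t0 : 0 <= t by rewrite ln_ge0// lerDl.
have et : expR t = 1 + x by rewrite lnK// posrE ltr_pwDl.
pose f : R -> R := expR - (expR \o -%R) - 2 *: id.
have df (s : R) : is_derive s 1 f (expR s + expR (- s) - 2).
  rewrite /f; apply: is_derive_eq; rewrite /= /GRing.scale/=; ring.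
have := is_derive_ge0_le t0 df.
rewrite /f /= !fctE /GRing.scale/= oppr0 expR0 expRN et.
have x1 : 1 + x != 0 by rewrite gt_eqF// ltr_pwDl.
move=> H; have -> : x * (2 + x) / (2 * (1 + x)) = ((1 + x) - (1 + x)^-1) / 2.
  by field.
suff : 0 <= 1 + x - (1 + x)^-1 - 2 * t by lra.
apply: le_trans (H _); first by lra.
move=> s _; rewrite expRN.
have e0 := expR_gt0 s; have e1 : expR s != 0 by rewrite gt_eqF.
have -> : expR s + (expR s)^-1 - 2 = (expR s - 1) ^+ 2 / expR s by field.
by rewrite divr_ge0 ?sqr_ge0// ltW.
Qed.

(** * Integrals of powers of the sine *)

(** Integration by parts of [sin^(m+2) = sin^(m+1) * sin] gives this recursion.
Having explicit antiderivatives reduces the integrals of [sin^n] to the mean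
value theorem, with no integration theory. *)
Fixpoint sin_primitive {R : realType} (n : nat) : R -> R :=
  match n with
  | 0 => id
  | 1 => - cos
  | m.+2 => m.+2%:R^-1 *: (m.+1%:R *: sin_primitive m - sin ^+ m.+1 * cos)
  end.

Lemma is_derive_sin_primitive {R : realType} (n : nat) (x : R) :
  is_derive x 1 (sin_primitive n : R -> R) (sin x ^+ n).
Proof.
have [m] := ubnP n; elim: m n => // m IH [|[|n]] nm.
- exact: is_derive_eq.
- by apply: is_derive_eq; rewrite opprK.
- rewrite /=.
  have dn := IH n (ltn_trans (ltnSn _) nm).
  apply: is_derive_eq.
  rewrite /GRing.scale /= !fctE -mulr_natr !mulrA.
  have -> : (sin x) ^+ n.+2 = sin x ^+ n * (1 - cos x ^+ 2).
    by rewrite -sin2cos2 -exprD addn2.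
  rewrite exprS.
  have n0 : n.+2%:R != 0 :> R by rewrite pnatr_eq0.
  rewrite -[n.+2]addn1 natrD in n0 *.
  have -> : sin x * sin x ^+ n * - sin x = - sin x ^+ n * (1 - cos x ^+ 2).
    by rewrite -sin2cos2; ring.
  by field.
Qed.

(** The integral of [sin^n] over [[0, pi/2]]. *)
Definition sin_int (R : realType) (n : nat) : R :=
  sin_primitive n (pi / 2) - sin_primitive n 0.

Lemma sin_int0 (R : realType) : sin_int R 0 = pi / 2.
Proof. by rewrite /sin_int /= subr0. Qed.

Lemma sin_int1 (R : realType) : sin_int R 1 = 1.
Proof. by rewrite /sin_int /= !fctE cos_pihalf cos0 oppr0 opprK add0r. Qed.

Lemma sin_intSS (R : realType) (n : nat) :
  sin_int R n.+2 = n.+1%:R / n.+2%:R * sin_int R n.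
Proof.
rewrite /sin_int /= !fctE /GRing.scale/= cos_pihalf sin0 expr0n /=.
by rewrite mulr0 mul0r !subr0 !mulrA -mulrBr [n.+2%:R^-1 * _]mulrC.
Qed.

(** On [[0, pi/2]] the powers of [sin] decrease, since [0 <= sin <= 1]. *)
Lemma sin_int_nincr (R : realType) (n : nat) : sin_int R n.+1 <= sin_int R n.
Proof.
pose f := @sin_primitive R n - sin_primitive n.+1.
have df (s : R) : is_derive s 1 f (sin s ^+ n - sin s ^+ n.+1).
  have d1 := is_derive_sin_primitive n s.
  have d2 := is_derive_sin_primitive n.+1 s.
  exact: is_deriveB.
have pi0 : (0 : R) <= pi / 2 by rewrite divr_ge0 ?pi_ge0.
suff : f 0 <= f (pi / 2) by rewrite /f !fctE /sin_int; lra.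
apply: is_derive_ge0_le pi0 df _ => x /itvP xI.
have s0 : 0 <= sin x.
  apply: sin_ge0_pi; rewrite xI /= (le_trans (y := pi / 2)) ?xI//.
  by rewrite ler_piMr ?pi_ge0// invf_le1// ler1n.
by rewrite subr_ge0 exprS ler_piMl ?exprn_ge0// sin_le1.
Qed.

(** The recursion [J (n+2) = (n+1)/(n+2) J n] makes the left-hand side
independent of [n]. *)
Lemma sin_int_mulS (R : realType) (n : nat) :
  n.+1%:R * (sin_int R n * sin_int R n.+1) = pi / 2.
Proof.
elim: n => [|n IH]; first by rewrite sin_int0 sin_int1 mul1r mulr1.
rewrite sin_intSS -IH; have : n.+2%:R != 0 :> R by rewrite pnatr_eq0.
by move=> n0; field.
Qed.

Lemma sin_int_ge0 (R : realType) (n : nat) : 0 <= sin_int R n.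
Proof.
have [m] := ubnP n; elim: m n => // m IH [|[|n]] nm.
- by rewrite sin_int0 divr_ge0 ?pi_ge0.
- by rewrite sin_int1.
- by rewrite sin_intSS mulr_ge0 ?divr_ge0 ?(IH _ (ltnW nm)).
Qed.

Lemma sin_int_double (R : realType) (n : nat) :
  sin_int R (2 * n) = (2 * n)`!%:R / (4 ^+ n * n`!%:R ^+ 2) * (pi / 2).
Proof.
elim: n => [|n IH]; first by rewrite sin_int0 expr0 expr1n mulr1 divr1 mul1r.
rewrite mulnS sin_intSS IH !factS !natrM [4 ^+ n.+1]exprS.
have f0 : n`!%:R != 0 :> R by rewrite pnatr_eq0 -lt0n fact_gt0.
have -> : (2 * n).+2%:R = 2 * n.+1%:R :> R by rewrite -natrM mulnS.
have n0 : n.+1%:R != 0 :> R by rewrite pnatr_eq0.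
have e0 : 4 ^+ n != 0 :> R by rewrite expf_neq0// pnatr_eq0.
by field; rewrite f0 e0 addrC natr1 n0.
Qed.

(** As [J] is nonincreasing, [J(n)^2] lies between [J(n) J(n+1)] and
[J(n-1) J(n)], both known by [sin_int_mulS]: hence [n J(n)^2] lies between
[pi/2 * n/(n+1)] and [pi/2]. *)
Lemma cvg_sin_int (R : realType) :
  ((fun n => n%:R * sin_int R n ^+ 2) @ \oo --> (pi / 2 : R))%classic.
Proof.
have p0 : 0 <= pi :> R by exact: pi_ge0.
apply: (squeeze_cvgr (f := fun n => pi / 2 - pi / 2 * harmonic n)
          (h := cst (pi / 2))); last exact: cvg_cst.
- exists 1%N => // -[//|n] _.
  have Jn := sin_int_mulS R n; have JSn := sin_int_mulS R n.+1.
  have d1 := sin_int_nincr R n; have d2 := sin_int_nincr R n.+1.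
  have q1 := sin_int_ge0 R n.+1.
  have n0 : n.+2%:R != 0 :> R by rewrite pnatr_eq0.
  rewrite /= expr2; apply/andP; split.
    have -> : pi / 2 - pi / 2 / n.+2%:R
        = n.+1%:R * (sin_int R n.+1 * sin_int R n.+2).
      rewrite -{1}JSn -[in pi / 2 / _]JSn.
      rewrite -[n.+2]addn1 natrD in n0 *.
      by field.
    by rewrite ler_wpM2l// ler_wpM2l.
  by rewrite -Jn ler_wpM2l// ler_wpM2r.
- have lE : pi / 2 - pi / 2 * 0 = pi / 2 :> R by rewrite mulr0 subr0.
  rewrite -[X in (_ --> X)%classic]lE.
  apply: cvgB; [exact: cvg_cst|].
  by apply: cvgM; [exact: cvg_cst|exact: cvg_harmonic].
Qed.

(** * Stirling's formula *)

Definition stirling_ratio (R : realType) (n : nat) : R :=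
  n`!%:R * expR 1 ^+ n / (n%:R ^+ n * Num.sqrt n%:R).

Lemma stirling_ratio_gt0 (R : realType) (n : nat) : 0 < stirling_ratio R n.+1.
Proof.
by rewrite divr_gt0 ?mulr_gt0 ?exprn_gt0 ?expR_gt0 ?sqrtr_gt0 ?ltr0n ?fact_gt0.
Qed.

Lemma ln_stirling_ratio (R : realType) (n : nat) :
  ln (stirling_ratio R n.+1)
  = ln n.+1`!%:R + n.+1%:R - (n.+1%:R + 1 / 2) * ln n.+1%:R.
Proof.
have n0 : 0 < n.+1%:R :> R by rewrite ltr0n.
have f0 : 0 < n.+1`!%:R :> R by rewrite ltr0n fact_gt0.
have e0 : 0 < expR 1 ^+ n.+1 :> R by rewrite exprn_gt0 ?expR_gt0.
have s0 : 0 < Num.sqrt n.+1%:R :> R by rewrite sqrtr_gt0.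
have p0 : 0 < n.+1%:R ^+ n.+1 :> R by rewrite exprn_gt0.
rewrite /stirling_ratio lnM ?posrE ?mulr_gt0 ?invr_gt0 ?mulr_gt0//.
rewrite lnV ?posrE ?mulr_gt0// !lnM ?posrE// !lnXn ?expR_gt0// expRK.
rewrite -powR12_sqrt ?ltW// ln_powR -[ln n.+1%:R *+ _]mulr_natr.
by field.
Qed.

Lemma ln_stirling_ratioB (R : realType) (n : nat) :
  ln (stirling_ratio R n.+1) - ln (stirling_ratio R n.+2)
  = (n.+1%:R + 1 / 2) * ln (1 + n.+1%:R^-1) - 1.
Proof.
have n0 : n.+1%:R != 0 :> R by rewrite pnatr_eq0.
have -> : 1 + n.+1%:R^-1 = n.+2%:R / n.+1%:R :> R.
  by rewrite -[n.+2]addn1 natrD; field.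
rewrite !ln_stirling_ratio [n.+2`!]factS natrM lnM ?posrE ?ltr0n ?fact_gt0//.
rewrite lnM ?posrE ?invr_gt0 ?ltr0n// lnV ?posrE ?ltr0n//.
have -> : n.+2%:R = n.+1%:R + 1 :> R by rewrite -[n.+2]addn1 natrD.
by field.
Qed.

(** For [x = 1/m], the lower bound [2x/(2+x)] of [ln (1+x)] is exactly
[1/(m + 1/2)]. *)
Lemma ln_stirling_ratio_nincr (R : realType) (n : nat) :
  ln (stirling_ratio R n.+2) <= ln (stirling_ratio R n.+1).
Proof.
rewrite -subr_ge0 ln_stirling_ratioB.
have n0 : 0 < n.+1%:R :> R by rewrite ltr0n.
have x0 : 0 <= n.+1%:R^-1 :> R by rewrite invr_ge0 ltW.
rewrite subr_ge0 mulrC -ler_pdivrMr ?addr_gt0// (le_trans _ (ln1p_ge x0))//.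
by rewrite le_eqVlt; apply/orP; left; apply/eqP; field; rewrite !gt_eqF//; lra.
Qed.

(** For [x = 1/m], multiplying the upper bound of [ln (1+x)] by [m + 1/2] gives
[(2m+1)^2 / (4m(m+1)) = 1 + 1/(4m(m+1))]. *)
Lemma ln_stirling_ratioB_le (R : realType) (n : nat) :
  ln (stirling_ratio R n.+1) - ln (stirling_ratio R n.+2)
  <= (4 * n.+1%:R)^-1 - (4 * n.+2%:R)^-1.
Proof.
rewrite ln_stirling_ratioB.
have n0 : 0 < n.+1%:R :> R by rewrite ltr0n.
have x0 : 0 <= n.+1%:R^-1 :> R by rewrite invr_ge0 ltW.
have -> : n.+2%:R = n.+1%:R + 1 :> R by rewrite -[n.+2]addn1 natrD.
move: n.+1%:R n0 x0 => y y0 x0.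
have y2 : 0 <= y + 1 / 2 by lra.
rewrite lerBlDr (le_trans (ler_wpM2l y2 (ln1p_le x0)))//.
by rewrite le_eqVlt; apply/orP; left; apply/eqP; field; rewrite !gt_eqF//; lra.
Qed.

Lemma cvg_stirling_ratio_gt0 (R : realType) :
  exists2 c : R, 0 < c & (stirling_ratio R @ \oo --> c)%classic.
Proof.
pose u n := ln (stirling_ratio R n.+1).
have ulb n : u 0%N - 4^-1 + (4 * n.+1%:R)^-1 <= u n.
  elim: n => [|n IH]; first by rewrite mulr1 subrK.
  have : u n - u n.+1 <= _ := ln_stirling_ratioB_le R n.
  move: (u 0%N) (u n) (u n.+1) (_^-1) (_^-1) (_^-1) IH => a b c d e f IH H.
  by lra.
have ucvg : cvgn u.
  apply: nonincreasing_is_cvgn.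
    by apply/nonincreasing_seqP => n; exact: ln_stirling_ratio_nincr.
  exists (u 0%N - 4^-1) => _ [n _ <-]; apply: le_trans (ulb n).
  by rewrite lerDl invr_ge0 mulr_ge0.
exists (expR (limn u)); first exact: expR_gt0.
rewrite -cvg_shiftS /=.
have -> : (fun n => stirling_ratio R n.+1) = expR \o u.
  by apply/funext => n /=; rewrite /u lnK// posrE stirling_ratio_gt0.
by apply: continuous_cvg => //; exact: continuous_expR.
Qed.

(** The powers of [e] and of [m] cancel between [A(m)^4] and [A(2m)^2]; the
factorials that remain form the central binomial coefficient, which is [J(2m)]
up to the factor [4^m] and [pi/2]. *)
Lemma stirling_ratio_double (R : realType) (m : nat) : (0 < m)%N ->
  stirling_ratio R m ^+ 4 * ((2 * m)%:R * sin_int R (2 * m) ^+ 2)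
  = pi ^+ 2 * stirling_ratio R (2 * m) ^+ 2.
Proof.
move=> m_gt0; have m0 : m%:R != 0 :> R by rewrite pnatr_eq0 -lt0n.
have s2 : Num.sqrt m%:R ^+ 2 = m%:R :> R by rewrite sqr_sqrtr.
have t2 : Num.sqrt (2 * m)%:R ^+ 2 = 2 * m%:R :> R.
  by rewrite sqr_sqrtr// natrM.
have s0 : Num.sqrt m%:R != 0 :> R by rewrite gt_eqF ?sqrtr_gt0 ?ltr0n ?muln_gt0.
have t0 : Num.sqrt (2 * m)%:R != 0 :> R.
  by rewrite gt_eqF ?sqrtr_gt0 ?ltr0n ?muln_gt0.
have f0 : m`!%:R != 0 :> R by rewrite pnatr_eq0 -lt0n fact_gt0.
have P0 : m%:R ^+ m != 0 :> R by rewrite expf_neq0.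
have T0 : 2 ^+ m != 0 :> R by rewrite expf_neq0// pnatr_eq0.
rewrite sin_int_double /stirling_ratio.
have -> : (2 * m)%:R ^+ (2 * m) = (2 ^+ m * m%:R ^+ m) ^+ 2 :> R.
  by rewrite [X in _ ^+ X]mulnC exprM natrM exprMn.
have -> : expR 1 ^+ (2 * m) = (expR 1 ^+ m) ^+ 2 :> R by rewrite mulnC exprM.
have -> : 4 ^+ m = (2 ^+ m) ^+ 2 :> R.
  by rewrite -exprM mulnC exprM; congr (_ ^+ _); rewrite -natrX.
rewrite !expr_div_n !exprMn t2 (exprM (Num.sqrt _) 2 2) s2 natrM.
move: (2 ^+ m) (m%:R ^+ m) (expR 1 ^+ m) T0 P0 => T P E T0 P0.
by field; rewrite T0 f0 m0 P0.
Qed.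

Lemma stirling (R : realType) :
  (stirling_ratio R @ \oo --> (Num.sqrt (2 * pi) : R))%classic.
Proof.
have [c c0 cA] := cvg_stirling_ratio_gt0 R.
suff -> : Num.sqrt (2 * pi) = c by [].
have pi0 : 0 < pi :> R by exact: pi_gt0.
have cdouble (u : nat -> R) (l : R) : (u @ \oo --> l)%classic ->
    ((fun n => u (2 * n)%N) @ \oo --> l)%classic.
  by move=> ul; apply: (cvg_comp (fun n => (2 * n)%N) u) ul; exact: cvg_mulnl.
pose s := stirling_ratio R.
have cl : ((s * s * (s * s) *
      (fun n => (2 * n)%:R * sin_int R (2 * n) ^+ 2)) @ \oo
    --> c * c * (c * c) * (pi / 2))%classic.
  apply: cvgM; first by do ?apply: cvgM.
  exact: (cdouble (fun n => n%:R * sin_int R n ^+ 2) _ (@cvg_sin_int R)).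
have cr : ((cst (pi ^+ 2) *
      ((fun n => s (2 * n)%N) * (fun n => s (2 * n)%N))) @ \oo
    --> pi ^+ 2 * (c * c))%classic.
  by apply: cvgM; [exact: cvg_cst | apply: cvgM; exact: cdouble].
have lE : c * c * (c * c) * (pi / 2) = pi ^+ 2 * (c * c).
  apply: (cvg_unique _ cl) => //.
  apply: cvg_trans cr; apply: near_eq_cvg; exists 1%N => // n n0 /=.
  have := stirling_ratio_double R n0; rewrite !fctE -/s => H.
  by rewrite -[s (2 * n)%N * _]expr2 -H; ring.
have -> : 2 * pi = c ^+ 2.
  have cpi : c * c * pi != 0 by rewrite !mulf_neq0// gt_eqF.
  by apply: (mulfI cpi); lra.
by rewrite sqrtr_sqr ger0_norm// ltW.
Qed.

(** * Comparison with the asymptotic equivalent *)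

Theorem corollary3 (R : realType) :
  (forall n : nat, unif_expectation (@park_prob R n) = 1 / (n`!)%:R)
  /\ asymp_equiv
       (fun n : nat => unif_expectation (@park_prob R n))
       (fun n : nat =>
          expR 1 ^+ n / (Num.sqrt (2 * pi) * n%:R `^ (n%:R + 1 / 2))).
Proof.
split; first by move=> n; exact: unif_expectation_park_prob.
rewrite /asymp_equiv; set w : R := Num.sqrt (2 * pi).
have w0 : w != 0 by rewrite gt_eqF// sqrtr_gt0 mulr_gt0 ?pi_gt0.
rewrite -[X in (_ --> X)%classic](divff w0).
have lim :
    ((cst w * (fun n => (stirling_ratio R n)^-1)) @ \oo --> w / w)%classic.
  by apply: cvgM; [exact: cvg_cst | exact: cvgV (@stirling R)].
(* Only positive [n] matter: at [n = 0] both sides divide by zero. *)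
apply: cvg_trans lim; apply: near_eq_cvg; exists 1%N => // n n_gt0 /=.
rewrite unif_expectation_park_prob !fctE /stirling_ratio.
have n0 : n%:R != 0 :> R by rewrite pnatr_eq0 -lt0n.
have -> : n%:R `^ (n%:R + 1 / 2) = n%:R ^+ n * Num.sqrt n%:R :> R.
  by rewrite powRD ?n0 ?implybT// powR_mulrn// div1r powR12_sqrt.
have s0 : Num.sqrt n%:R != 0 :> R by rewrite gt_eqF ?sqrtr_gt0 ?ltr0n.
have p0 : n%:R ^+ n != 0 :> R by rewrite expf_neq0.
have e0 : expR 1 ^+ n != 0 :> R by rewrite expf_neq0// gt_eqF// expR_gt0.
have f0 : n`!%:R != 0 :> R by rewrite pnatr_eq0 -lt0n fact_gt0.
by field; rewrite ?f0 ?e0 ?p0 ?s0 ?w0.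
Qed.
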